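(* Let $R$ be a quotient root system with base $S$ and let $\Phi \subseteq R^+$ be a non-empty inversion set. The following are equivalent: (i) $\Phi$ is irreducible; (ii) every connected component $C$ of $G_\Phi^{\Phi^c}$ satisfies $\operatorname{supp} C = \operatorname{supp} \Phi$; (iii) $G_\Phi^{\Phi^c}$ has a unique simple component; (iv) there exists a component $A$ of $G_\Phi^{\Phi^c}$ such that every other component $C$ of $G_\Phi^{\Phi^c}$ satisfies $C = kA$ for some integer $k \geq 1$.
   Context: A quotient root system (QRS) $R$ is the set of non-zero images of a root system $\Delta$ (with base $\Sigma$) under the orthogonal projection of its ambient Euclidean space onto $(\mathrm{span}\,J)^\perp$ for some $J\subsetneq\Sigma$; its base $S$ consists of the images of $\Sigma\setminus J$, and every root is an integer combination of $S$ with all coefficients $\ge0$ (positive roots, $R^+$) or all $\le0$. The support $\operatorname{supp}\alpha$ of a root is the set of $\theta\in S$ with non-zero coefficient in $\alpha$; the support of a set is the union of the supports of its elements. $\Phi\subseteq R^+$ is closed if $\alpha,\beta\in\Phi$, $\alpha+\beta\in R$ imply $\alpha+\beta\in\Phi$; co-closed if $\Phi^c := R^+\setminus\Phi$ is closed; an inversion set if both. A non-empty inversion set $\Phi$ is irreducible if whenever $\Phi=\Phi_1\sqcup\Phi_2$ with $\Phi_1,\Phi_2$ disjoint inversion sets, then $\Phi_1=\Phi$ or $\Phi_2=\Phi$. $G_\Phi^{\Phi^c}$ is the graph with vertex set $\Phi$ in which $\alpha,\alpha'$ are adjacent iff $\alpha-\alpha'\in \Phi^c\cup(-\Phi^c)$;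 ''components'' are its connected components (as sets of roots). Addition of components: for components $A,B$ let $Z=\{\alpha+\beta:\alpha\in A,\beta\in B\}\cap R$. If $Z\neq\emptyset$ and $Z$ lies in a single component $C$, then $A+B:=C$. If $Z$ meets more than one component, then (as established in the paper) $A=B$ and $Z$ meets exactly two components, $A$ and some $C\ne A$; then $A+A:=C$. If $Z=\emptyset$, $A+B$ is undefined. For components $C_1,\dots,C_n$ the standard sum $C_1+\cdots+C_n$ means $(\cdots((C_1+C_2)+C_3)+\cdots)+C_n$, required to have every partial sum defined; $kA$ is the standard sum of $k$ copies of $A$. A component $C$ is simple if whenever $A+B=C$ for components $A,B$, then $A=C$ or $B=C$. *)

(* Defs.v *)
From HB Require Import structures.
From mathcomp Require Import all_boot all_order all_algebra.
From mathcomp Require Import reals.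
From Stdlib Require Import Relation_Operators.
Set Implicit Arguments. Unset Strict Implicit. Unset Printing Implicit Defensive.
Import Order.TTheory GRing.Theory Num.Theory.
Local Open Scope ring_scope.

Definition vset (R : realType) (n : nat) := 'rV[R]_n -> Prop.

Section QRS.
Variables (R : realType) (n : nat) (I : finType).

Definition dot (u v : 'rV[R]_n) : R := (u *m v^T) 0 0.

Definition cartan (b a : 'rV[R]_n) : R := 2 * dot b a / dot a a.

Definition reflect_vec (a b : 'rV[R]_n) : 'rV[R]_n := b - cartan b a *: a.

Definition is_root_system (D : seq 'rV[R]_n) : Prop :=
  [/\ 0 \notin D,
      forall a b, a \in D -> b \in D -> reflect_vec a b \in D,
      forall a b, a \in D -> b \in D -> exists z : int, cartan b a = z%:~R
    & forall a (c : R), a \in D -> c *: a \in D -> c = 1 \/ c = -1].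

Definition is_base (D : seq 'rV[R]_n) (Sig : I -> 'rV[R]_n) : Prop :=
  [/\ forall i, Sig i \in D,
      forall c : I -> R, \sum_i c i *: Sig i = 0 -> forall i, c i = 0
    & forall a, a \in D -> exists k : I -> int,
        a = \sum_i (k i)%:~R *: Sig i /\
        ((forall i, 0 <= k i) \/ (forall i, k i <= 0))].

Variables (D : seq 'rV[R]_n) (Sig : I -> 'rV[R]_n) (J : {set I}).

Definition proj_rel (v w : 'rV[R]_n) : Prop :=
  (forall j, j \in J -> dot w (Sig j) = 0) /\
  exists c : I -> R, v - w = \sum_(j in J) c j *: Sig j.

Definition qroot (w : 'rV[R]_n) : Prop :=
  w != 0 /\ exists a, a \in D /\ proj_rel a w.

(* k : I -> int gives the coefficients of w on the base S = {theta_i | i \notin J},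
   theta_i the projection of Sig i *)
Definition qcoeffs (w : 'rV[R]_n) (k : I -> int) : Prop :=
  (forall i, i \in J -> k i = 0) /\
  exists theta : I -> 'rV[R]_n, (forall i, proj_rel (Sig i) (theta i)) /\
    w = \sum_(i in ~: J) (k i)%:~R *: theta i.

Definition qpos (w : 'rV[R]_n) : Prop :=
  qroot w /\ exists k, qcoeffs w k /\ forall i, 0 <= k i.

(* theta_i (identified with i \notin J) belongs to supp w *)
Definition in_supp (w : 'rV[R]_n) (i : I) : Prop :=
  exists k, qcoeffs w k /\ k i != 0.

Definition set_supp (A : vset R n) (i : I) : Prop :=
  exists w, A w /\ in_supp w i.

Definition closed_set (P : vset R n) : Prop :=
  (forall w, P w -> qpos w) /\
  forall a b, P a -> P b -> qroot (a + b) -> P (a + b).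

Definition compl (P : vset R n) : vset R n := fun w => qpos w /\ ~ P w.

Definition inversion_set (P : vset R n) : Prop :=
  closed_set P /\ closed_set (compl P).

Definition irreducible (P : vset R n) : Prop :=
  inversion_set P /\ (exists w, P w) /\
  forall P1 P2, inversion_set P1 -> inversion_set P2 ->
    (forall w, ~ (P1 w /\ P2 w)) ->
    (forall w, P w <-> P1 w \/ P2 w) ->
    P1 = P \/ P2 = P.

Variable Phi : vset R n.

Definition adj (a b : 'rV[R]_n) : Prop :=
  Phi a /\ Phi b /\ (compl Phi (a - b) \/ compl Phi (b - a)).

Definition component (C : vset R n) : Prop :=
  exists a, Phi a /\ C = (fun b => Phi b /\ clos_refl_trans _ adj a b).

Definition sumset (A B : vset R n) : vset R n :=
  fun z => qroot z /\ exists a b, A a /\ B b /\ z = a + b.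

Definition csum (A B C : vset R n) : Prop :=
  [/\ component A, component B, component C & (exists z, sumset A B z) /\
  ((forall z, sumset A B z -> C z) \/
   ((exists C1 C2, component C1 /\ component C2 /\ C1 <> C2 /\
      (exists z, sumset A B z /\ C1 z) /\ (exists z, sumset A B z /\ C2 z)) /\
    A = B /\ C <> A /\ exists z, sumset A B z /\ C z))].

Fixpoint kmul (k : nat) (A C : vset R n) : Prop :=
  match k with
  | 0 => False
  | k'.+1 => match k' with
             | 0 => component A /\ C = A
             | _ => exists E, kmul k' A E /\ csum E A C
             end
  end.

Definition simple_comp (C : vset R n) : Prop :=
  component C /\ forall A B, csum A B C -> A = C \/ B = C.

End QRS.

(* Main.v *)
(* A quotient root system inherits from root systems the property that roots
   with negative inner product have a root or 0 as their sum. Consequently, if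
   u, v, w and u + v + w are roots and no two of u, v, w cancel, then u + v or
   u + w is a root ([qroot_sum3]). Applied to u + v with u, v in Phi and to an
   edge u -- u', this says that either u' + v is a root, or v can be moved along
   an edge so as to keep the sum, or u' is adjacent to u + v ([move_summand]).

   Three facts on components follow. If the component of u + v is not that of
   u, every u' in the component of u lies below some element of the component
   of u + v, so "adding an element of Phi" is a strict partial order on
   components ([below]). If it is neither that of u nor that of v, every element
   of it splits in the same way ([conn_split]). And for distinct components A
   and B, if A + B meets a component other than A and B, it lies in that
   component ([sum_conn]). In particular the simple components are those that
   contain a simple root.

   (i) => (ii): if theta is missing from the support of some component but not
   from that of Phi, separating the components according to whether theta is in
   their support decomposes Phi.
   (ii) => (iii): if a simple root theta in Phi is in the support of a component
   A, then the component of theta is A or is below A; two simple components of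
   full support would therefore be below each other.
   (iii) => (iv): by splitting, every root in Phi is a sum of roots of the simple
   component A; these can be added one after the other through roots.
   (iv) => (i): a decomposition of Phi is compatible with components and with
   their addition, so one of its parts contains A and then everything. *)

Require Import Defs.
From HB Require Import structures.
From mathcomp Require Import all_boot all_order all_algebra.
From mathcomp Require Import zify ring lra.
From mathcomp Require Import reals boolp.
From Stdlib Require Import Relation_Operators Operators_Properties.
Set Implicit Arguments. Unset Strict Implicit. Unset Printing Implicit Defensive.
Import Order.TTheory GRing.Theory Num.Theory.
Local Open Scope ring_scope.

Ltac vec := apply/rowP => ?; rewrite !mxE; ring.

(** * The quotient root system *)

Section Dot.
Variables (R : realType) (n : nat).
Implicit Types u v w : 'rV[R]_n.

Lemma dotE u v : dot u v = \sum_k u 0 k * v 0 k.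
Proof. by rewrite /dot mxE; apply: eq_bigr => k _; rewrite mxE. Qed.

Lemma dotC u v : dot u v = dot v u.
Proof. by rewrite !dotE; apply: eq_bigr => k _; rewrite mulrC. Qed.

Lemma dotDl u v w : dot (u + v) w = dot u w + dot v w.
Proof. by rewrite /dot mulmxDl mxE. Qed.

Lemma dotZl c u v : dot (c *: u) v = c * dot u v.
Proof. by rewrite /dot -scalemxAl mxE. Qed.

Lemma dotNl u v : dot (- u) v = - dot u v.
Proof. by rewrite -scaleN1r dotZl mulN1r. Qed.

Lemma dotDr u v w : dot u (v + w) = dot u v + dot u w.
Proof. by rewrite dotC dotDl !(dotC u). Qed.

Lemma dotZr c u v : dot u (c *: v) = c * dot u v.
Proof. by rewrite dotC dotZl dotC. Qed.

Lemma dotNr u v : dot u (- v) = - dot u v.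
Proof. by rewrite dotC dotNl dotC. Qed.

Lemma dot0l u : dot 0 u = 0.
Proof. by rewrite /dot mul0mx mxE. Qed.

Lemma dot0r u : dot u 0 = 0.
Proof. by rewrite dotC dot0l. Qed.

Lemma dot_suml (T : Type) (r : seq T) (P : pred T) (F : T -> 'rV[R]_n) v :
  dot (\sum_(i <- r | P i) F i) v = \sum_(i <- r | P i) dot (F i) v.
Proof.
by elim/big_rec2: _ => [|i x y _ <-]; rewrite ?dot0l ?dotDl.
Qed.

Lemma dot_sumr (T : Type) (r : seq T) (P : pred T) (F : T -> 'rV[R]_n) v :
  dot v (\sum_(i <- r | P i) F i) = \sum_(i <- r | P i) dot v (F i).
Proof. by rewrite dotC dot_suml; apply: eq_bigr => i _; rewrite dotC. Qed.

Lemma dot_ge0 u : 0 <= dot u u.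
Proof. by rewrite dotE; apply: sumr_ge0 => k _; rewrite -expr2 sqr_ge0. Qed.

Lemma dot_eq0 u : dot u u = 0 -> u = 0.
Proof.
rewrite dotE => u0; apply/rowP => k; rewrite mxE; apply/eqP.
rewrite -sqrf_eq0 expr2; apply/eqP.
by apply: (psumr_eq0P _ u0) => // i _; rewrite -expr2 sqr_ge0.
Qed.

Lemma dot_gt0 u : u <> 0 -> 0 < dot u u.
Proof.
move=> u0; rewrite lt_def dot_ge0 andbT; apply/eqP => h; exact/u0/dot_eq0.
Qed.

End Dot.

Section QuotientRoots.
Variables (R : realType) (n : nat) (I : finType).
Variables (D : seq 'rV[R]_n) (Sig : I -> 'rV[R]_n) (J : {set I}).
Hypothesis hD : is_root_system D.
Hypothesis hS : is_base D Sig.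

Let D0 a : a \in D -> a <> 0.
Proof. by case: hD => h _ _ _ aD a0; rewrite -a0 aD in h. Qed.

Lemma root_opp a : a \in D -> - a \in D.
Proof.
move=> aD; case: hD => _ h _ _; have := h a a aD aD.
have a0 := dot_gt0 (D0 aD).
rewrite /reflect_vec /cartan -mulrA divff ?gt_eqF // mulr1 scaler_nat.
by rewrite mulr2n opprD addrA subrr add0r.
Qed.

Lemma cartan_neg a b : a \in D -> b \in D -> dot b a < 0 ->
  cartan b a = -1 \/ dot b a <= - dot a a.
Proof.
move=> aD bD ab; case: hD => _ _ hz _; have [z hz'] := hz _ _ aD bD.
have a0 := dot_gt0 (D0 aD).
have ba : dot b a = z%:~R / 2 * dot a a.
  by rewrite -hz' /cartan; field; rewrite gt_eqF.
have z0 : z < 0.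
  by rewrite -(ltrz0 R) -hz' /cartan pmulr_llt0 ?invr_gt0 // pmulr_rlt0.
have [z1|z1] := eqVneq z (-1); first by left; rewrite hz' z1.
right; have z2 : z%:~R <= (-2)%:~R :> R by rewrite ler_int; lia.
rewrite ba -mulN1r; apply: ler_wpM2r; first exact: ltW.
by lra.
Qed.

(** If one of the two Cartan integers is -1, a reflection produces a + b. Otherwise both are at most
    -2, so (a, b) <= -(a, a) and (a, b) <= -(b, b), whence |a + b|^2 <= 0. *)
Lemma root_add a b : a \in D -> b \in D -> dot a b < 0 ->
  a + b = 0 \/ a + b \in D.
Proof.
move=> aD bD ab; case: (hD) => _ hr _ _.
have [h|h1] := cartan_neg bD aD ab.
  by right; have := hr _ _ bD aD; rewrite /reflect_vec h scaleN1r opprK.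
have [h|h2] : cartan b a = -1 \/ dot b a <= - dot a a.
- by apply: cartan_neg; rewrite // dotC.
- by right; have := hr _ _ aD bD; rewrite /reflect_vec h scaleN1r opprK addrC.
left; apply: dot_eq0; apply/eqP; rewrite eq_le dot_ge0 andbT.
rewrite dotDl !dotDr; move: h2; rewrite (dotC b a); lra.
Qed.

(** * Orthogonal projection along [J] *)

Definition base_mx : 'M[R]_(#|I|, n) := \matrix_i Sig (enum_val i).

Definition levi_mx : 'M[R]_(#|I|, n) :=
  \matrix_i (if enum_val i \in J then Sig (enum_val i) else 0).

(** The Gram matrix formula. Zero rows of [levi_mx] can make the Gram matrix singular, hence
    [pinvmx]. *)
Definition qproj (v : 'rV[R]_n) : 'rV[R]_n :=
  v - v *m levi_mx^T *m pinvmx (levi_mx *m levi_mx^T) *m levi_mx.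

Lemma qprojD u v : qproj (u + v) = qproj u + qproj v.
Proof. by rewrite /qproj !mulmxDl opprD addrACA. Qed.

Lemma qprojZ c v : qproj (c *: v) = c *: qproj v.
Proof. by rewrite /qproj -!scalemxAl scalerBr. Qed.

Lemma qproj0 : qproj 0 = 0.
Proof. by have := qprojZ 0 0; rewrite !scale0r. Qed.

Lemma qproj_sum (T : Type) (r : seq T) (P : pred T) (F : T -> 'rV[R]_n) :
  qproj (\sum_(i <- r | P i) F i) = \sum_(i <- r | P i) qproj (F i).
Proof. by elim/big_rec2: _ => [|i x y _ <-]; rewrite ?qproj0 ?qprojD. Qed.

(** If x N N^T = 0 then |x N|^2 = 0, so N N^T and N have the same rank. This is what makes [pinvmx]
    cancel in [qproj_orth]. *)
Lemma tr_sub_gram m (N : 'M[R]_(m, n)) : (N^T <= N *m N^T)%MS.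
Proof.
have h : (kermx (N *m N^T) <= kermx N)%MS.
  apply/sub_kermxP; set K := kermx _.
  apply/row_matrixP => i; rewrite row0; apply: dot_eq0.
  rewrite /dot row_mul trmx_mul mulmxA -(mulmxA (row i K)).
  by rewrite -row_mul mulmx_ker row0 mul0mx mxE.
have := mxrankS h; rewrite !mxrank_ker => h'.
have := mxrank_leqif_sup (submxMl N N^T) => -[h1 <-].
by move: h'; rewrite eqn_leq h1 mxrank_tr leq_sub2lE ?rank_leq_row.
Qed.

Lemma qproj_orth v j : j \in J -> dot (qproj v) (Sig j) = 0.
Proof.
move=> jJ; have h : qproj v *m levi_mx^T = 0.
  rewrite /qproj mulmxBl -[X in _ - X]mulmxA.
  by rewrite mulmxKpV ?subrr // (submx_trans (submxMl _ _)) // tr_sub_gram.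
have := congr1 (fun M : 'rV[R]__ => M 0 (enum_rank j)) h.
rewrite !mxE dotE => h'; rewrite -[RHS]h'; apply: eq_bigr => k _.
by rewrite !mxE enum_rankK jJ.
Qed.

Lemma qproj_rel v : proj_rel Sig J v (qproj v).
Proof.
split=> [j|]; first exact: qproj_orth.
set c := v *m levi_mx^T *m pinvmx (levi_mx *m levi_mx^T).
exists (fun i => c 0 (enum_rank i)).
rewrite /qproj -/c opprB addrC subrK mulmx_sum_row.
rewrite [RHS]big_mkcond [RHS](reindex (enum_val : 'I_#|I| -> I)) /=; last first.
  by exists enum_rank => i _; rewrite ?enum_valK ?enum_rankK.
apply: eq_bigr => i _; rewrite enum_valK rowK.
by case: ifP; rewrite ?scaler0.
Qed.

Lemma proj_rel_uniq v w : proj_rel Sig J v w -> w = qproj v.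
Proof.
have [o' [c' e']] := qproj_rel v; move=> [o [c e]].
apply/eqP; rewrite -subr_eq0; apply/eqP/dot_eq0.
have {2}-> : w - qproj v = \sum_(j in J) (c' j - c j) *: Sig j.
  under eq_bigr do rewrite scalerBl.
  by rewrite sumrB -e -e' [- (v - w)]opprB [RHS]addrC addrA subrK.
rewrite dot_sumr big1 // => j jJ.
by rewrite dotZr dotDl dotNl o // o' // subr0 mulr0.
Qed.

Lemma qproj_id v : (forall j, j \in J -> dot v (Sig j) = 0) -> qproj v = v.
Proof.
move=> o; symmetry; apply: proj_rel_uniq; split=> //.
by exists (fun=> 0); rewrite subrr big1 // => i _; rewrite scale0r.
Qed.

Lemma qproj_Sig j : j \in J -> qproj (Sig j) = 0.
Proof.
move=> jJ; symmetry; apply: proj_rel_uniq; split=> [i _|]; first exact: dot0l.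
exists (fun i => (i == j)%:R); rewrite subr0 (bigD1 j) //= eqxx scale1r.
by rewrite big1 ?addr0 // => i /andP[_ /negbTE ->]; rewrite scale0r.
Qed.

Lemma dot_qproj u v : (forall j, j \in J -> dot u (Sig j) = 0) ->
  dot u (qproj v) = dot u v.
Proof.
move=> o; have [_ [c e]] := qproj_rel v.
have {2}-> : v = qproj v + (v - qproj v) by rewrite addrC subrK.
by rewrite dotDr e dot_sumr big1 ?addr0 // => j jJ; rewrite dotZr o // mulr0.
Qed.

Lemma qrootP w :
  qroot D Sig J w <-> w <> 0 /\ exists2 a, a \in D & w = qproj a.
Proof.
split=> [[/eqP w0 [a [aD /proj_rel_uniq wa]]]|[w0 [a aD wa]]].
  by split=> //; exists a.
by split; [exact/eqP|exists a; split=> //; rewrite wa; exact: qproj_rel].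
Qed.

(** * Coefficients on the base *)

Lemma base_free : row_free base_mx.
Proof.
rewrite -kermx_eq0; apply/eqP/row_matrixP => r; rewrite row0.
have h : row r (kermx base_mx) *m base_mx = 0 by rewrite -row_mul mulmx_ker row0.
case: hS => _ hi _; move: h; set u := row r _.
rewrite mulmx_sum_row => h; apply/rowP => i; rewrite [RHS]mxE.
rewrite -[i]enum_valK; apply: (hi (fun i => u 0 (enum_rank i))).
rewrite (reindex (enum_val : 'I_#|I| -> I)) /=; last first.
  by exists enum_rank => k _; rewrite ?enum_valK ?enum_rankK.
by rewrite -[RHS]h; apply: eq_bigr => k _; rewrite enum_valK rowK.
Qed.

(** Linear on the whole space, so it applies to sums not known to be roots; vanishing for indices in
    [J] makes it invariant under [qproj]. *)
Definition coef (i : I) (v : 'rV[R]_n) : R :=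
  (i \notin J)%:R * (v *m pinvmx base_mx) 0 (enum_rank i).

Lemma coefD i u v : coef i (u + v) = coef i u + coef i v.
Proof. by rewrite /coef mulmxDl mxE mulrDr. Qed.

Lemma coefZ i c v : coef i (c *: v) = c * coef i v.
Proof. by rewrite /coef -scalemxAl mxE mulrCA. Qed.

Lemma coef0 i : coef i 0 = 0.
Proof. by have := coefZ i 0 0; rewrite scale0r mul0r. Qed.

Lemma coefN i v : coef i (- v) = - coef i v.
Proof. by rewrite -scaleN1r coefZ mulN1r. Qed.

Lemma coef_sum i (T : Type) (r : seq T) (P : pred T) (F : T -> 'rV[R]_n) :
  coef i (\sum_(j <- r | P j) F j) = \sum_(j <- r | P j) coef i (F j).
Proof. by elim/big_rec2: _ => [|j x y _ <-]; rewrite ?coef0 ?coefD. Qed.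

Lemma coef_Sig i j : coef i (Sig j) = ((i \notin J) && (i == j))%:R.
Proof.
have -> : Sig j = row (enum_rank j) base_mx by rewrite rowK enum_rankK.
rewrite /coef -row_mul mulmxVp ?base_free // !mxE.
by rewrite -natrM mulnb (inj_eq enum_rank_inj) eq_sym.
Qed.

Lemma coef_qproj i v : coef i (qproj v) = coef i v.
Proof.
have [_ [c e]] := qproj_rel v.
have {2}-> : v = qproj v + (v - qproj v) by rewrite addrC subrK.
rewrite coefD e coef_sum big1 ?addr0 // => j jJ.
by rewrite coefZ coef_Sig; case: eqP => [->|]; rewrite ?jJ ?andbF mulr0.
Qed.

Lemma coef_sum_Sig i (k : I -> R) :
  coef i (\sum_j k j *: Sig j) = (i \notin J)%:R * k i.
Proof.
rewrite coef_sum (bigD1 i) //= big1 ?addr0 => [|j ji].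
  by rewrite coefZ coef_Sig eqxx andbT mulrC.
by rewrite coefZ coef_Sig eq_sym (negbTE ji) andbF mulr0.
Qed.

Definition theta i := qproj (Sig i).

Lemma coef_theta i j : coef i (theta j) = ((i \notin J) && (i == j))%:R.
Proof. by rewrite coef_qproj coef_Sig. Qed.

Lemma qproj_sum_theta (k : I -> R) :
  qproj (\sum_j k j *: Sig j) = \sum_(j in ~: J) k j *: theta j.
Proof.
rewrite qproj_sum [RHS]big_mkcond; apply: eq_bigr => j _; rewrite inE qprojZ.
by case: ifPn => //; rewrite negbK => jJ; rewrite qproj_Sig // scaler0.
Qed.

Lemma qroot_coef w : qroot D Sig J w -> exists k : I -> int,
  [/\ w = \sum_(i in ~: J) (k i)%:~R *: theta i,
      forall i, i \in J -> k i = 0, forall i, coef i w = (k i)%:~R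
    & (forall i, 0 <= k i) \/ (forall i, k i <= 0)].
Proof.
move=> /qrootP[w0 [a aD wa]].
case: hS => _ _ /(_ a aD) [k [ak hk]].
exists (fun i => if i \in J then 0 else k i); split.
- rewrite wa ak qproj_sum_theta; apply: eq_bigr => i.
  by rewrite inE => /negbTE ->.
- by move=> i ->.
- by move=> i; rewrite wa coef_qproj ak coef_sum_Sig; case: ifP; rewrite ?mul0r ?mul1r.
by case: hk => hk; [left|right] => i; case: ifP.
Qed.

Lemma qcoeffs_coef w (k : I -> int) :
  qcoeffs Sig J w k -> forall i, coef i w = (k i)%:~R.
Proof.
move=> [kJ [t [ht ->]]] i.
under eq_bigr do rewrite (proj_rel_uniq (ht _)) -/(theta _).
rewrite -(qproj_sum_theta (fun i => (k i)%:~R)) coef_qproj coef_sum_Sig.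
by case: (boolP (i \in J)) => [/kJ ->|_]; rewrite ?mulr0 ?mul1r.
Qed.

Lemma qroot_qcoeffs w : qroot D Sig J w ->
  exists2 k : I -> int, qcoeffs Sig J w k & forall i, coef i w = (k i)%:~R.
Proof.
move=> /qroot_coef[k [wk kJ ck _]]; exists k => //; split=> //.
by exists theta; split=> // i; exact: qproj_rel.
Qed.

Lemma in_suppP w i : qroot D Sig J w -> in_supp Sig J w i <-> coef i w <> 0.
Proof.
move=> /qroot_qcoeffs[k hk ck]; split=> [[k' [hk' /eqP ki]]|].
  by rewrite (qcoeffs_coef hk') => /eqP; rewrite intr_eq0 => /eqP.
move=> c0; exists k; split=> //; apply/eqP => k0; apply: c0.
by rewrite ck k0.
Qed.

Lemma qposP w :
  qpos D Sig J w <-> qroot D Sig J w /\ forall i, 0 <= coef i w.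
Proof.
split=> [[rw [k [hk k0]]]|[rw c0]]; split=> //.
  by move=> i; rewrite (qcoeffs_coef hk) ler0z.
have [k hk ck] := qroot_qcoeffs rw; exists k; split=> // i.
by rewrite -(ler0z R) -ck.
Qed.

Lemma qroot_neq0 w : qroot D Sig J w -> w <> 0.
Proof. by move=> /qrootP[]. Qed.

Lemma qroot_opp w : qroot D Sig J w -> qroot D Sig J (- w).
Proof.
move=> /qrootP[w0 [a aD wa]]; apply/qrootP; split.
  by move=> h; apply: w0; rewrite -[w]opprK h oppr0.
by exists (- a); rewrite ?root_opp // wa -scaleN1r -qprojZ scaleN1r.
Qed.

Lemma qpos_or_opp w :
  qroot D Sig J w -> qpos D Sig J w \/ qpos D Sig J (- w).
Proof.
move=> rw; have [k [_ _ ck [k0|k0]]] := qroot_coef rw; [left|right]; apply/qposP.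
  by split=> // i; rewrite ck ler0z.
by split=> [|i]; [exact: qroot_opp|rewrite coefN ck oppr_ge0 lerz0].
Qed.

Lemma qroot_coef_neq0 w : qroot D Sig J w -> exists i, coef i w <> 0.
Proof.
move=> rw; apply: contrapT => h.
apply: (qroot_neq0 rw); have [k [wk _ ck _]] := qroot_coef rw.
rewrite wk big1 // => i _; rewrite -ck.
suff -> : coef i w = 0 by rewrite scale0r.
by apply: contrapT => c0; apply: h; exists i.
Qed.

Lemma qroot_of_lift a : a \in D -> qproj a = 0 \/ qroot D Sig J (qproj a).
Proof.
move=> aD; have [->|/eqP h] := eqVneq (qproj a) 0; first by left.
by right; apply/qrootP; split=> //; exists a.
Qed.

(* Reflections in the roots of J permute the lifts of u, so the sum of the
   lifts is orthogonal to J, hence a positive multiple of u. *)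
Lemma sum_lifts u : qroot D Sig J u ->
  exists2 s : seq 'rV[R]_n,
    {subset s <= D} /\ (forall a, a \in s -> qproj a = u)
    & exists2 m : nat, (0 < m)%N & \sum_(a <- s) a = m%:R *: u.
Proof.
move=> /qrootP[u0 [a0 a0D ua]].
(* [D] may repeat roots; after [undup], stability under a reflection yields a permutation. *)
pose s := [seq a <- undup D | qproj a == u].
have sP a : (a \in s) = (a \in D) && (qproj a == u).
  by rewrite mem_filter mem_undup andbC.
exists s.
  by split=> a; rewrite sP => /andP[// _ /eqP].
have s_uniq : uniq s by rewrite filter_uniq ?undup_uniq.
exists (size s).
  by have := sP a0; rewrite a0D ua eqxx; case: (s).
have so j : j \in J -> dot (\sum_(a <- s) a) (Sig j) = 0.
  move=> jJ; case: (hS) => SD _ _; have Sj := SD j.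
  have Sj0 := dot_gt0 (D0 Sj).
  pose f := reflect_vec (Sig j).
  have fE x : f x = x - (2 * dot x (Sig j) / dot (Sig j) (Sig j)) *: Sig j by [].
  have fK : involutive f.
    move=> x; rewrite !fE dotDl dotNl dotZl -addrA -opprD -scalerDl.
    rewrite -[RHS]subr0; congr (_ - _); rewrite -[RHS](scale0r (Sig j)).
    by congr (_ *: _); field; rewrite gt_eqF.
  have fs : perm_eq (map f s) s.
    apply: uniq_perm => //; first by rewrite map_inj_uniq //; exact: inv_inj.
    have sub : {subset map f s <= s}.
      move=> _ /mapP[x xs ->]; move: xs; rewrite !sP => /andP[xD /eqP xu].
      case: hD => _ hr _ _; rewrite hr //=.
      by rewrite fE -scaleNr qprojD qprojZ qproj_Sig // scaler0 addr0 xu.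
    move=> x; apply/idP/idP => [/sub //|xs]; apply/mapP; exists (f x).
      by apply: sub; apply: map_f.
    by rewrite fK.
  have : \sum_(a <- s) f a = \sum_(a <- s) a.
    by rewrite -(big_map f xpredT id) (perm_big _ fs).
  under eq_bigr do rewrite fE.
  rewrite sumrB -scaler_suml => /eqP; rewrite -[eqbRHS]subr0 (inj_eq (addrI _)).
  rewrite eqr_opp scaler_eq0 -mulr_suml -mulr_sumr -dot_suml.
  case/orP => /eqP; last by move=> /(D0 Sj).
  by move/eqP; rewrite !mulf_eq0 invr_eq0 pnatr_eq0 (gt_eqF Sj0) orbF => /eqP.
rewrite -(qproj_id so) qproj_sum big_seq.
rewrite (eq_bigr (fun=> u)) => [|a]; last by rewrite sP => /andP[_ /eqP].
by rewrite -big_seq big_const_seq count_predT iter_addr_0 scaler_nat.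
Qed.

(** The lifts of u add up to m u with m > 0, so for a lift b of v some lift a of u has (a, b) < 0.
    Then [root_add] applies to a + b, which projects to u + v. *)
Lemma qroot_add u v : qroot D Sig J u -> qroot D Sig J v -> dot u v < 0 ->
  u + v = 0 \/ qroot D Sig J (u + v).
Proof.
move=> ru rv uv; have [s [sD su] [m m0 sE]] := sum_lifts ru.
have /qrootP[_ [b bD vb]] := rv.
have uo j : j \in J -> dot u (Sig j) = 0.
  by case/qrootP: ru => _ [a _ ->]; exact: qproj_orth.
have [a as_ ab] : exists2 a, a \in s & dot a b < 0.
  apply: contrapT => h.
  suff : 0 <= dot (\sum_(a <- s) a) b.
    rewrite sE dotZl pmulr_rge0 ?ltr0n // -(dot_qproj _ uo) -vb.
    by rewrite leNgt uv.
  rewrite dot_suml big_seq; apply: sumr_ge0 => a as_.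
  by rewrite leNgt; apply/negP => ab; apply: h; exists a.
rewrite -(su a as_) vb -qprojD.
have [->|abD] := root_add (sD a as_) bD ab; first by rewrite qproj0; left.
exact: qroot_of_lift.
Qed.

(** * Heights and descent *)

Definition height (v : 'rV[R]_n) : R := \sum_i coef i v.

Lemma heightD u v : height (u + v) = height u + height v.
Proof. by rewrite /height -big_split; apply: eq_bigr => i _; rewrite coefD. Qed.

Lemma qpos_height w : qpos D Sig J w -> exists m : nat, height w = m.+1%:R.
Proof.
move=> /qposP[rw c0]; have [k _ ck] := qroot_qcoeffs rw.
have e : height w = (\sum_i k i)%:~R.
  by rewrite /height rmorph_sum; apply: eq_bigr.
have : 0 < height w.
  rewrite lt_def sumr_ge0 // andbT; apply/eqP => h.
  have [i] := qroot_coef_neq0 rw; apply.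
  exact: (psumr_eq0P (fun i _ => c0 i) h).
rewrite e ltr0z; case: (\sum_i k i) => // -[//|m] _.
by exists m.
Qed.

Lemma qpos_height_bound :
  exists N : nat, forall w, qpos D Sig J w -> height w < N%:R.
Proof.
pose hs := [seq height (qproj a) | a <- D].
(* Each height is at most the sum of all absolute heights. *)
exists (Num.truncn (\sum_(h <- hs) `|h|)).+1 => w /qposP[/qrootP[_ [a aD ->]] _].
apply: (le_lt_trans _ (truncnS_gt _)).
rewrite big_map (big_rem a) //=.
apply: le_trans (ler_norm _) _; rewrite lerDl.
by apply: sumr_ge0.
Qed.

Lemma qpos_theta i : i \notin J -> qpos D Sig J (theta i).
Proof.
move=> iJ; apply/qposP; split; last by move=> j; rewrite coef_theta ler0n.
case: hS => SD _ _; apply/qrootP; split; last by exists (Sig i).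
by move=> h; have := coef_theta i i; rewrite h coef0 iJ eqxx => /eqP; rewrite eq_sym oner_eq0.
Qed.

(** Expanding (w, w) > 0 along the base gives i with positive coefficient and (w, theta_i) > 0. The
    coefficient is an integer, so it stays nonnegative when theta_i is subtracted. *)
Lemma qpos_descend w : qpos D Sig J w -> exists2 i, i \notin J &
  w = theta i \/ qpos D Sig J (w - theta i).
Proof.
move=> /qposP[rw c0]; have [k [wk _ ck _]] := qroot_coef rw.
have [i [iJ ki wi]] : exists i, [/\ i \notin J, 0 < k i & 0 < dot w (theta i)].
  apply: contrapT => h; have := dot_gt0 (qroot_neq0 rw).
  rewrite {2}wk dot_sumr => /lt_geF/negP; apply.
  apply: sumr_le0 => i; rewrite inE dotZr -ck => iJ.
  have [->|cn] := eqVneq (coef i w) 0; first by rewrite mul0r.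
  apply: mulr_ge0_le0 => //; rewrite leNgt; apply/negP => wi; apply: h.
  exists i; split=> //; rewrite -(ltr0z R) -ck lt_def cn; exact: c0.
exists i => //; have /qposP[rt _] := qpos_theta iJ.
have [|h|h] := qroot_add rw (qroot_opp rt); first by rewrite dotNr oppr_lt0.
  by left; apply/eqP; rewrite -subr_eq0 h.
right; apply/qposP; split=> // j; rewrite coefD coefN coef_theta.
case: eqP => [->|_]; last by rewrite andbF subr0.
by rewrite iJ subr_ge0 ck ler1z.
Qed.

Local Notation rt := (qroot D Sig J).
Local Notation pos := (qpos D Sig J).

Lemma qpos_addr_neq0 u v : pos u -> pos v -> u + v <> 0.
Proof.
move=> /qpos_height[k hk] /qpos_height[l hl] uv0.
have : height (u + v) = 0 by rewrite uv0 /height big1 // => i _; rewrite coef0.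
by rewrite heightD hk hl -natrD => /eqP; rewrite pnatr_eq0.
Qed.

Lemma qpos_add u v : pos u -> pos v -> rt (u + v) -> pos (u + v).
Proof.
move=> /qposP[_ u0] /qposP[_ v0] ruv; apply/qposP; split=> // i.
by rewrite coefD addr_ge0.
Qed.

Lemma qpos_oppF u : pos u -> pos (- u) -> False.
Proof. by move=> pu /(qpos_addr_neq0 pu); rewrite subrr. Qed.

Lemma qroot_sub u v : rt u -> rt v -> 0 < dot u v -> u - v = 0 \/ rt (u - v).
Proof.
by move=> ru /qroot_opp rv uv; apply: qroot_add => //; rewrite dotNr oppr_lt0.
Qed.

(** Let s = u + v + w. If neither u + v = s - w nor u + w = s - v is a root, then (u, v), (u, w) >=
    0 and (s, v), (s, w) <= 0. Adding the last two gives (u, v) + (u, w) + |v + w|^2 <= 0, so v + w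
    = 0. *)
Lemma qroot_sum3 u v w : rt u -> rt v -> rt w -> rt (u + v + w) ->
  u + v <> 0 -> u + w <> 0 -> v + w <> 0 -> rt (u + v) \/ rt (u + w).
Proof.
move=> ru rv rw rs uv uw vw; apply: contrapT => /not_orP[nuv nuw].
have h1 : 0 <= dot u v by rewrite leNgt; apply/negP => /(qroot_add ru rv)[].
have h2 : 0 <= dot u w by rewrite leNgt; apply/negP => /(qroot_add ru rw)[].
have h3 : dot (u + v + w) v <= 0.
  by rewrite leNgt; apply/negP => /(qroot_sub rs rv); rewrite addrAC addrK => -[].
have h4 : dot (u + v + w) w <= 0.
  by rewrite leNgt; apply/negP => /(qroot_sub rs rw); rewrite addrK => -[].
apply/vw/dot_eq0/eqP; rewrite eq_le dot_ge0 andbT.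
by move: h1 h2 h3 h4; rewrite !(dotDl, dotDr); lra.
Qed.

(** * The graph of an inversion set *)

Variable Phi : vset R n.
Hypothesis hPhi : inversion_set D Sig J Phi.

Local Notation Psi := (compl D Sig J Phi).
Local Notation edge := (adj D Sig J Phi).
Local Notation conn := (clos_refl_trans _ edge).

Lemma Phi_pos u : Phi u -> pos u.
Proof. by case: hPhi => -[h _] _; exact: h. Qed.

Lemma Psi_pos u : Psi u -> pos u.
Proof. by case. Qed.

Lemma pos_rt u : pos u -> rt u.
Proof. by case. Qed.

Lemma Phi_rt u : Phi u -> rt u.
Proof. by move=> /Phi_pos/pos_rt. Qed.

Lemma Phi_add u v : Phi u -> Phi v -> rt (u + v) -> Phi (u + v).
Proof. by case: hPhi => -[_ h] _; exact: h. Qed.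

Lemma Psi_add u v : Psi u -> Psi v -> rt (u + v) -> Psi (u + v).
Proof. by case: hPhi => _ [_ h]; exact: h. Qed.

Lemma Phi_or_Psi u : pos u -> Phi u \/ Psi u.
Proof. by move=> pu; have [|] := pselect (Phi u); [left|right]. Qed.

(** Symmetric under negation, which lets edges be handled without an orientation. *)
Definition spsi v := Psi v \/ Psi (- v).

Lemma spsi_opp v : spsi v -> spsi (- v).
Proof. by case=> h; [right; rewrite opprK|left]. Qed.

Lemma edgeP u v : edge u v <-> [/\ Phi u, Phi v & spsi (v - u)].
Proof.
split=> [[hu [hv h]]|[hu hv h]]; split=> //; rewrite /spsi ?opprB in h *.
  by case: h; [right|left].
by split=> //; case: h; [right|left].
Qed.

Lemma edgeC u v : edge u v -> edge v u.
Proof. by case=> hu [hv h]; split=> //; split=> //; case: h; [right|left]. Qed.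

Lemma edge_addr u v w : edge u v -> Phi w -> rt (u + w) -> rt (v + w) ->
  edge (u + w) (v + w).
Proof.
move=> /edgeP[hu hv h] hw ru rv; apply/edgeP; split; try exact: Phi_add.
by rewrite opprD addrACA subrr addr0.
Qed.

Lemma conn_refl u : conn u u. Proof. exact: rt_refl. Qed.

Lemma conn_edge u v : edge u v -> conn u v. Proof. exact: rt_step. Qed.

Lemma conn_trans v u w : conn u v -> conn v w -> conn u w.
Proof. exact: rt_trans. Qed.

Lemma conn_sym u v : conn u v -> conn v u.
Proof.
elim=> [x y /edgeC|x|x y z _ h1 _ h2]; [exact: rt_step|exact: rt_refl|].
exact: rt_trans h2 h1.
Qed.

Lemma conn_Phi u v : conn u v -> Phi u -> Phi v.
Proof. by elim=> [x y [_ []]|x|x y z _ h1 _ h2 hx] //; auto. Qed.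

(** The length is recorded for the inductions on distance in [walk_dot_ge0] and [sum_conn_walk]. *)
Fixpoint walk k u v : Prop :=
  if k is k'.+1 then exists2 w, edge u w & walk k' w v else u = v.

Lemma walk_rcons k u v w : walk k u v -> edge v w -> walk k.+1 u w.
Proof.
elim: k u => [|k IH] u /= => [->|[x ux xv]] vw; first by exists w.
by exists x => //; exact: IH.
Qed.

Lemma walk_sym k u v : walk k u v -> walk k v u.
Proof.
elim: k u => [|k IH] u /= => [->//|[x ux /IH xv]].
exact: walk_rcons xv (edgeC ux).
Qed.

Lemma walk_conn k u v : walk k u v -> conn u v.
Proof.
elim: k u => [|k IH] u /= => [->|[x ux /IH xv]]; first exact: rt_refl.
exact: rt_trans (rt_step _ _ _ _ ux) xv.
Qed.

Lemma conn_ind u (P : 'rV[R]_n -> Prop) :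
  P u -> (forall x y, conn u x -> P x -> edge x y -> P y) ->
  forall v, conn u v -> P v.
Proof.
move=> Pu Pe v uv; elim: (clos_rt_rtn1 _ _ _ _ uv) => // x y xy ux.
move/Pe; apply=> //; exact: clos_rtn1_rt.
Qed.

Lemma conn_walk u v : conn u v -> exists k, walk k u v.
Proof.
move: v; apply: conn_ind => [|x y _ [k hk] xy]; first by exists 0.
by exists k.+1; exact: walk_rcons hk xy.
Qed.

Lemma sub_spsi_neq0 u p : Phi u -> spsi p -> u - p <> 0.
Proof.
move=> hu hp h; have e : u = p by apply/eqP; rewrite -subr_eq0 h.
case: hp; first by case=> _; rewrite -e.
by rewrite -e => /Psi_pos; apply: qpos_oppF; exact: Phi_pos.
Qed.

Lemma spsi_rt p : spsi p -> rt p.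
Proof.
by case=> /Psi_pos/pos_rt // /qroot_opp; rewrite opprK.
Qed.

(** The remaining case, p - u in [Phi], would put p in [Phi] by closure, whereas p is in [Psi] or
    negative. *)
Lemma sub_spsi u p : Phi u -> spsi p -> rt (u - p) -> Phi (u - p) \/ spsi (u - p).
Proof.
move=> hu hp ru; case: (qpos_or_opp ru) => /Phi_or_Psi[]; try by [left|right; left|right; right].
rewrite opprB => hpu; have : Phi p.
  by rewrite -(subrKC u p); apply: Phi_add; rewrite // subrKC; exact: spsi_rt.
case: hp => [[_ //]|/Psi_pos np /Phi_pos pp].
by case: (qpos_oppF pp np).
Qed.

(** With p = u' - u, [qroot_sum3] for v + u' - p = u + v makes v + u' or v - p a root. In the latter
    case v - p is in [Phi] and can replace v, or it is in [spsi] and is the difference of u + v and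
    u'. *)
Lemma move_summand u v u' : Phi u -> Phi v -> rt (u + v) -> edge u u' ->
  [\/ rt (u' + v), edge v (v - (u' - u)) | edge u' (u + v)].
Proof.
move=> hu hv ruv uu'; have /edgeP[_ hu' hp] := uu'; set p := u' - u in hp *.
have hp' := spsi_opp hp.
have e : v + u' - p = u + v by rewrite /p; vec.
have := @qroot_sum3 v u' (- p); rewrite e; case.
- exact: Phi_rt.
- exact: Phi_rt.
- exact: spsi_rt.
- exact: ruv.
- by apply: qpos_addr_neq0; exact: Phi_pos.
- exact: sub_spsi_neq0.
- by rewrite /p opprB subrKC; exact/qroot_neq0/Phi_rt.
- by rewrite addrC; constructor 1.
move=> rvp; have [h|h] := sub_spsi hv hp rvp.
  constructor 2; apply/edgeP; split=> //.
  by rewrite addrAC subrr sub0r.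
constructor 3; apply/edgeP; split=> //; first exact: Phi_add.
by rewrite (_ : u + v - u' = v - p) // /p; vec.
Qed.

(** Along a path from u, [move_summand] either moves the sum along an edge, or changes the other
    summand and keeps the sum. Its third case would join u to u + v. *)
Lemma conn_summand u v u' :
  Phi u -> Phi v -> rt (u + v) -> ~ conn u (u + v) -> conn u u' ->
  exists w, [/\ Phi w, rt (u' + w) & conn (u + v) (u' + w)].
Proof.
move=> hu hv ruv nuv; move: u'; apply: conn_ind => [|x y ux [w [hw rxw xw]] xy].
  by exists v; split=> //; exact: conn_refl.
have hx := conn_Phi ux hu.
have [h|h|h] := move_summand hx hw rxw xy.
- exists w; split=> //; apply: conn_trans xw _.
  by apply: conn_edge; exact: edge_addr.
- have e : y + (w - (y - x)) = x + w by vec.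
  by exists (w - (y - x)); rewrite e; split=> //; have /edgeP[] := h.
- case: nuv; apply: conn_trans ux _; apply: conn_trans (conn_sym xw).
  by apply: conn_trans (conn_edge xy) (conn_edge h).
Qed.

(** Every element of the first component must be exceeded, so that the relation can be iterated. *)
Definition below u v := forall u', conn u u' ->
  exists2 v', conn v v' & height u' < height v'.

Lemma below_trans u v w : below u v -> below v w -> below u w.
Proof.
move=> uv vw u' /uv[v' /vw[w' ww' h2] h1].
by exists w' => //; exact: lt_trans h1 h2.
Qed.

(** Otherwise one could climb forever inside the component; heights are integers, so they would pass
    the bound of [qpos_height_bound]. *)
Lemma below_irr u : Phi u -> ~ below u u.
Proof.
move=> hu uu; have [N hN] := qpos_height_bound.
suff h m : exists2 v, conn u v & m%:R <= height v.
  have [v uv] := h N; rewrite leNgt hN //.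
  exact: Phi_pos (conn_Phi uv hu).
elim: m => [|m [v uv mv]].
  have [m hm] := qpos_height (Phi_pos hu).
  by exists u; [exact: conn_refl|rewrite hm ler_nat].
have [w uw vw] := uu v uv; exists w => //.
have [k hk] := qpos_height (Phi_pos (conn_Phi uv hu)).
have [l hl] := qpos_height (Phi_pos (conn_Phi uw hu)).
move: mv vw; rewrite hk hl !ler_nat ltr_nat => a b; exact: leq_ltn_trans a b.
Qed.

Lemma height_gt0 u : pos u -> 0 < height u.
Proof. by move=> /qpos_height[m ->]; rewrite ltr0n. Qed.

Lemma below_add u v : Phi u -> Phi v -> rt (u + v) ->
  conn u (u + v) \/ below u (u + v).
Proof.
move=> hu hv ruv; have [|nuv] := pselect (conn u (u + v)); first by left.
right=> u' /(conn_summand hu hv ruv nuv)[w [hw _ h]]; exists (u' + w) => //.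
by rewrite heightD ltrDl; apply: height_gt0; exact: Phi_pos.
Qed.

(** If x = u' + v' has a neighbour y = x - p, then [qroot_sum3] for -p, u', v' allows p to be taken
    off u' or off v'; [sub] shows that the result stays in the same component. *)
Lemma conn_split u v w : Phi u -> Phi v -> rt (u + v) ->
  ~ conn u (u + v) -> ~ conn v (u + v) -> conn (u + v) w ->
  exists u' v', [/\ conn u u', conn v v' & w = u' + v'].
Proof.
move=> hu hv ruv nu nv; move: w.
(* If b - p is not in [Phi], it is in [spsi] and is the difference of b + c - p and c, which would
   join c to b + c. *)
have sub a b p c : conn a b -> Phi b -> Phi c -> edge (b + c) (b + c - p) ->
    spsi p -> ~ conn c (b + c) -> rt (b - p) -> conn a (b - p).
  move=> ab hb hc e hp nc rbp; have [h|h] := sub_spsi hb hp rbp.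
    apply: conn_trans ab _; apply/conn_edge/edgeP; split=> //.
    by rewrite addrAC subrr sub0r; exact: spsi_opp.
  case: nc; apply: conn_sym; apply: conn_trans (conn_edge e) _.
  have /edgeP[_ h' _] := e; apply/conn_edge/edgeP; split=> //.
  rewrite -opprB; apply: spsi_opp.
  by rewrite (_ : b + c - p - c = b - p) //; vec.
apply: conn_ind => [|x y uvx [u' [v' [uu' vv' ex]]] xy].
  by exists u, v; split=> //; exact: conn_refl.
have hu' := conn_Phi uu' hu; have hv' := conn_Phi vv' hv.
have /edgeP[hx hy hp] := xy; pose p := x - y.
have {}hp : spsi p by rewrite /p -opprB; exact: spsi_opp.
have ey : y = x - p by rewrite /p; vec.
have nu' : ~ conn u' x.
  by move=> h; apply: nu; apply: conn_trans uu' (conn_trans h (conn_sym uvx)).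
have nv' : ~ conn v' x.
  by move=> h; apply: nv; apply: conn_trans vv' (conn_trans h (conn_sym uvx)).
have := @qroot_sum3 (- p) u' v'; case.
- by apply: spsi_rt; exact: spsi_opp.
- exact: Phi_rt.
- exact: Phi_rt.
- by rewrite -addrA -ex addrC -ey; exact: Phi_rt.
- by rewrite addrC; exact: sub_spsi_neq0.
- by rewrite addrC; exact: sub_spsi_neq0.
- by apply: qpos_addr_neq0; exact: Phi_pos.
- rewrite addrC => h; exists (u' - p), v'; split=> //.
    by apply: (@sub u u' p v') => //; rewrite -ex -?ey.
  by rewrite ey ex; vec.
- rewrite addrC => h; exists u', (v' - p); split=> //.
    by apply: (@sub v v' p u') => //; rewrite (addrC v') -ex -?ey.
  by rewrite ey ex; vec.
Qed.

(* Along the walk from y to z every step either shortens the distance between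
   the pairs (x, y) and (al, z), which hmin forbids, or keeps the sum g. *)
Lemma walk_dot_ge0 al z g m : Phi g -> ~ conn z g ->
  (forall x y p q, Phi x -> Phi y -> walk p x al -> walk q y z ->
     (p + q < m)%N -> rt (x + y) -> ~ conn g (x + y)) ->
  forall j i x y, Phi x -> Phi y -> x + y = g -> walk i x al -> walk j y z ->
    (i + j = m)%N -> 0 <= dot g (z - y).
Proof.
move=> hg nzg hmin; elim=> [|j IH] i x y hx hy exy wi /= wj ijm.
  by rewrite wj subrr dot0r.
have [y1 yy1 wj1] := wj; have /edgeP[_ hy1 hp] := yy1.
have nr : ~ rt (y1 + x).
  move=> r; apply: (hmin x y1 i j) => //; rewrite 1?addrC //.
    by rewrite -ijm addnS.
  rewrite -exy (addrC x); apply/conn_edge/edge_addr => //.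
  by rewrite addrC exy; exact: Phi_rt.
have ryx : rt (y + x) by rewrite addrC exy; exact: Phi_rt.
have [//|h|h] := move_summand hy hx ryx yy1; last first.
  case: nzg; apply: conn_trans (conn_sym (walk_conn wj1)) _.
  by rewrite -exy addrC; exact: conn_edge.
have /edgeP[_ hx1 _] := h.
have -> : z - y = (z - y1) + (y1 - y) by vec.
rewrite dotDr addr_ge0 //.
  apply: (IH i.+1 _ y1 hx1) => //; first by rewrite -exy; vec.
    by exists x => //; exact: edgeC.
  by rewrite addSnnS.
(* Were (g, y1 - y) negative, y1 + x would be a root, against [nr], or zero. *)
rewrite leNgt; apply/negP => /(qroot_add (Phi_rt hg) (spsi_rt hp)).
rewrite (_ : g + (y1 - y) = y1 + x); last by rewrite -exy; vec.
by case=> // /qpos_addr_neq0; apply; exact: Phi_pos.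
Qed.

(* Induction on the total distance m between the pairs (x, y) and (x', y'). As
   long as x <> x', moving x towards x' shortens the total or preserves x + y.
   Once x = x', [walk_dot_ge0] applies in both directions and gives
   |y' - y|^2 <= 0. *)
Lemma sum_conn_walk m : forall p q x y x' y', (p + q = m)%N ->
  walk p x x' -> walk q y y' -> Phi x -> Phi y -> rt (x + y) -> rt (x' + y') ->
  ~ conn x (x + y) -> ~ conn y (x + y) -> ~ conn y (x' + y') ->
  conn (x + y) (x' + y').
Proof.
elim/ltn_ind: m => m IHm; elim=> [|p IHp] q x y x' y' pqm wp wq hx hy r r' nx ny ny'.
  rewrite -wp in r' ny' *; have hy' := conn_Phi (walk_conn wq) hy.
  have hg := Phi_add hx hy r; have hg' := Phi_add hx hy' r'.
  apply: contrapT => ngg'.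
  have yy' := walk_conn wq.
  have h1 : 0 <= dot (x + y) (y' - y).
    apply: (@walk_dot_ge0 x y' (x + y) m hg _ _ q 0 x y) => //.
      by move=> h; apply: ny; exact: conn_trans yy' h.
    (* By the outer induction, a closer pair with sum connected to x + y would connect x + y to x +
       y'. *)
    move=> x1 y1 p1 q1 hx1 hy1 w1 w2 lt1 r1 g1; apply: ngg'.
    apply: (conn_trans g1); apply: (IHm _ lt1 p1 q1) => //.
    - move=> h; apply: nx; apply: conn_trans (conn_sym (walk_conn w1)) _.
      exact: conn_trans h (conn_sym g1).
    - move=> h; apply: ny; apply: conn_trans yy' _.
      apply: conn_trans (conn_sym (walk_conn w2)) _.
      exact: conn_trans h (conn_sym g1).
    - move=> h; apply: ny'; apply: conn_trans yy' _.
      by apply: conn_trans (conn_sym (walk_conn w2)) _.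
  have wq' := walk_sym wq.
  have h2 : 0 <= dot (x + y') (y - y').
    apply: (@walk_dot_ge0 x y (x + y') m hg' _ _ q 0 x y') => //.
    move=> x1 y1 p1 q1 hx1 hy1 w1 w2 lt1 r1 g1; apply: ngg'.
    apply: (conn_trans _ (conn_sym g1)); apply: (IHm _ lt1 p1 q1) => //.
    - exact: walk_sym.
    - exact: walk_sym.
    - by move=> h; apply: ny'; apply: conn_trans h (conn_sym g1).
  apply: ngg'; suff -> : y = y' by exact: conn_refl.
  apply/eqP; rewrite -subr_eq0; apply/eqP/dot_eq0/eqP.
  rewrite eq_le dot_ge0 andbT; move: h1 h2.
  by rewrite !(dotDl, dotDr, dotNl, dotNr) (dotC y' y); lra.
have [x1 xx1 wp1] := wp; have /edgeP[_ hx1 _] := xx1.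
have [h|h|h] := move_summand hx hy r xx1.
- have e := conn_edge (edge_addr xx1 hy r h); have f := conn_sym e.
  apply: conn_trans e _; apply: (IHm (p + q)%N _ p q) => //.
  + by rewrite -pqm.
  + move=> h'; apply: nx; apply: conn_trans (conn_edge xx1) _.
    exact: conn_trans h' f.
  + by move=> h'; apply: ny; exact: conn_trans h' f.
- have e : x1 + (y - (x1 - x)) = x + y by vec.
  have yy1 := conn_edge (edgeC h).
  rewrite -e; apply: (IHp q.+1) => //; rewrite ?e //.
  + by rewrite -pqm addSnnS.
  + by exists y => //; exact: edgeC.
  + by have /edgeP[] := h.
  + by move=> h'; apply: nx; apply: conn_trans (conn_edge xx1) _.
  + by move=> h'; apply: ny; apply: conn_trans (conn_sym yy1) _.
  + by move=> h'; apply: ny'; apply: conn_trans (conn_sym yy1) _.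
- by case: nx; apply: conn_trans (conn_edge xx1) (conn_edge h).
Qed.

(** [sum_conn_walk] needs y not connected to x' + y'. If it is, then x is not, since x and y are not
    connected, and the roles of x and y are exchanged. *)
Lemma sum_conn x y x' y' : Phi x -> Phi y -> conn x x' -> conn y y' ->
  rt (x + y) -> rt (x' + y') -> ~ conn x y ->
  ~ conn x (x + y) -> ~ conn y (x + y) -> conn (x + y) (x' + y').
Proof.
move=> hx hy xx' yy' r r' nxy nx ny.
have [p wp] := conn_walk xx'; have [q wq] := conn_walk yy'.
have [h|h] := pselect (conn y (x' + y')); last exact: sum_conn_walk wp wq _ _ _ _ _ _ _.
rewrite addrC (addrC x') in nx ny r r' h *.
apply: sum_conn_walk wq wp _ _ _ _ _ _ _ => //.
by move=> h'; apply: nxy; exact: conn_trans h' (conn_sym h).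
Qed.

(** * Sums of components *)

Definition cl u : vset R n := fun v => Phi v /\ conn u v.

Lemma cl_self u : Phi u -> cl u u.
Proof. by split=> //; exact: conn_refl. Qed.

Lemma cl_conn u v : conn u v -> cl u = cl v.
Proof.
move=> uv; apply/funext => w; apply/propext; split=> -[hw h]; split=> //.
  exact: conn_trans (conn_sym uv) h.
exact: conn_trans uv h.
Qed.

Lemma cl_inj u v : Phi v -> cl u = cl v -> conn u v.
Proof. by move=> hv e; have := cl_self hv; rewrite -e => -[]. Qed.

Lemma component_cl u : Phi u -> component D Sig J Phi (cl u).
Proof. by exists u. Qed.

Lemma componentP C : component D Sig J Phi C -> exists2 u, Phi u & C = cl u.
Proof. by case=> u [hu ->]; exists u. Qed.

Lemma component_mem C u : component D Sig J Phi C -> C u -> Phi u /\ C = cl u.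
Proof. by move=> /componentP[v hv ->] [hu vu]; split=> //; exact: cl_conn. Qed.

(** By [sum_conn], a sum outside the component of u + v forces u and v to be connected; this is the
    exceptional clause of [csum]. *)
Lemma csum_cl u v : Phi u -> Phi v -> rt (u + v) ->
  ~ conn u (u + v) -> ~ conn v (u + v) ->
  csum D Sig J Phi (cl u) (cl v) (cl (u + v)).
Proof.
move=> hu hv r nu nv; have hw := Phi_add hu hv r.
have zw : sumset D Sig J (cl u) (cl v) (u + v).
  by split=> //; exists u, v; split; [|split]; rewrite //; exact: cl_self.
split; try exact: component_cl; split; first by exists (u + v).
have [h|h] := pselect (forall z, sumset D Sig J (cl u) (cl v) z -> cl (u + v) z).
  by left.
right; have [z [[rz [x [y [[hx ux] [[hy vy] ez]]]]] nz]] :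
    exists z, sumset D Sig J (cl u) (cl v) z /\ ~ cl (u + v) z.
  by apply: contrapT => h'; apply: h => z hz; apply: contrapT => nz; apply: h'; exists z.
have hz : Phi z by rewrite ez; apply: Phi_add; rewrite -?ez.
have nwz : ~ conn (u + v) z by move=> h'; apply: nz.
have uv : conn u v.
  apply: contrapT => nuv; apply: nwz; rewrite ez.
  by apply: sum_conn; rewrite -?ez.
split; last split; first exists (cl (u + v)), (cl z).
- do 2![split; first exact: component_cl]; split; first by move=> /cl_inj; auto.
  split; first by exists (u + v); split=> //; exact: cl_self.
  exists z; split; last exact: cl_self.
  by split=> //; exists x, y.
- exact: cl_conn.
- split; first by move=> /esym/cl_inj; auto.
  by exists (u + v); split=> //; exact: cl_self.
Qed.

Lemma csum_mem A B C : csum D Sig J Phi A B C ->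
  exists x y, [/\ A x, B y, rt (x + y) & C (x + y)].
Proof.
case=> _ _ _ [[z hz] h].
have [{hz}z [[rz [x [y [Ax [By ez]]]]] Cz]] : exists z, sumset D Sig J A B z /\ C z.
  by case: h => [h|[_ [_ [_ //]]]]; exists z; split=> //; exact: h.
by exists x, y; rewrite -ez.
Qed.

(** * Simple components and simple roots *)

Definition indec u := forall x y, Phi x -> Phi y -> rt (x + y) ->
  conn u (x + y) -> conn u x \/ conn u y.

Lemma simple_compP u : Phi u -> simple_comp D Sig J Phi (cl u) <-> indec u.
Proof.
move=> hu; split=> [[_ hs] x y hx hy r uxy|hi].
  apply: contrapT => /not_orP[nx ny].
  have nx' : ~ conn x (x + y).
    by move=> h; apply: nx; exact: conn_trans uxy (conn_sym h).
  have ny' : ~ conn y (x + y).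
    by move=> h; apply: ny; exact: conn_trans uxy (conn_sym h).
  have := csum_cl hx hy r nx' ny'; rewrite -(cl_conn uxy) => /hs.
  by case=> /esym/cl_inj; auto.
split=> [|A B hc]; first exact: component_cl.
have [hA hB _ _] := hc; have [x [y [Ax By r [_ uxy]]]] := csum_mem hc.
have [hx ->] := component_mem hA Ax; have [hy ->] := component_mem hB By.
by case: (hi x y hx hy r uxy) => /cl_conn ->; [left|right].
Qed.

Lemma height_theta i : i \notin J -> height (theta i) = 1.
Proof.
move=> iJ; rewrite /height (bigD1 i) //= coef_theta iJ eqxx big1 ?addr0 // => j ji.
by rewrite coef_theta (negbTE ji) andbF.
Qed.

(** Otherwise [conn_split] would write theta_i, of height 1, as a sum of two positive roots. *)
Lemma indec_theta i : i \notin J -> Phi (theta i) -> indec (theta i).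
Proof.
move=> iJ hi x y hx hy r ixy; apply: contrapT => /not_orP[nx ny].
have [||x' [y' [xx' yy' e]]] := conn_split hx hy r _ _ (conn_sym ixy).
- by move=> h; apply: nx; exact: conn_trans ixy (conn_sym h).
- by move=> h; apply: ny; exact: conn_trans ixy (conn_sym h).
have := height_theta iJ; rewrite e heightD.
have [k ->] := qpos_height (Phi_pos (conn_Phi xx' hx)).
have [l ->] := qpos_height (Phi_pos (conn_Phi yy' hy)).
by rewrite -natrD => /eqP; rewrite pnatr_eq1 addSn addnS.
Qed.

Lemma height_ind (P : 'rV[R]_n -> Prop) :
  (forall v, pos v -> (forall w, pos w -> height w < height v -> P w) -> P v) ->
  forall v, pos v -> P v.
Proof.
move=> IH v /[dup] pv /qpos_height[m hm].
elim/ltn_ind: m v pv hm => m IHm v pv hm; apply: IH => // w pw.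
have [k hk] := qpos_height pw; rewrite hk hm ltr_nat => km.
exact: (IHm k).
Qed.

Lemma height_sub_theta v i : i \notin J -> height (v - theta i) < height v.
Proof.
move=> /height_theta hi; rewrite -[X in _ < height X](subrK (theta i)).
by rewrite (heightD (v - _)) hi ltrDl ltr01.
Qed.

(** Descend inside the component through v = (v - theta_i) + theta_i. If both parts are in [Phi],
    indecomposability keeps one of them connected to u; if just one is in [Psi], the other is
    adjacent to v. *)
Lemma indec_conn_theta u : Phi u -> indec u ->
  exists i, [/\ i \notin J, Phi (theta i) & conn u (theta i)].
Proof.
move=> hu iu; suff h v : pos v -> conn u v ->
    exists i, [/\ i \notin J, Phi (theta i) & conn u (theta i)].
  by apply: (h u); [exact: Phi_pos|exact: conn_refl].
move: v; apply: height_ind => v pv IH uv; have hv := conn_Phi uv hu.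
have [i iJ [vi|pvi]] := qpos_descend pv; first by exists i; rewrite -vi.
have lt := height_sub_theta v iJ; have pt := qpos_theta iJ.
have ev : (v - theta i) + theta i = v by rewrite subrK.
have [hw|hw] := Phi_or_Psi pvi; have [ht|ht] := Phi_or_Psi pt.
- have := iu _ _ hw ht; rewrite ev => /(_ (Phi_rt hv) uv)[]; first exact: (IH _ pvi lt).
  by exists i.
- apply: (IH _ pvi lt); apply: conn_trans uv _; apply/conn_edge/edgeP; split=> //.
  by rewrite addrAC subrr sub0r; right; rewrite opprK.
- exists i; split=> //; apply: conn_trans uv _; apply/conn_edge/edgeP; split=> //.
  by right; rewrite opprB.
- have := Psi_add hw ht; rewrite ev => /(_ (Phi_rt hv)).
  by case.
Qed.

Lemma Phi_theta u : Phi u -> exists2 i, i \notin J & Phi (theta i).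
Proof.
move=> /[dup] hu /Phi_pos; move: u hu; suff h v : pos v -> Phi v ->
    exists2 i, i \notin J & Phi (theta i) by move=> u hu pu; exact: h pu hu.
move: v; apply: height_ind => v pv IH hv.
have [i iJ [vi|pvi]] := qpos_descend pv; first by exists i; rewrite -?vi.
have [hw|hw] := Phi_or_Psi pvi; first exact: IH pvi (height_sub_theta v iJ) hw.
have [ht|ht] := Phi_or_Psi (qpos_theta iJ); first by exists i.
have := Psi_add hw ht; rewrite subrK => /(_ (Phi_rt hv)).
by case.
Qed.

(* Phrased with partial sums that are roots, rather than as "v plus a sum of
   elements of Phi lies in the component of a", so that closure under taking
   summands of v is an induction. *)
Inductive reach (a : 'rV[R]_n) : 'rV[R]_n -> Prop :=
| reach_conn v : conn a v -> reach a v
| reach_add v x : Phi x -> rt (v + x) -> reach a (v + x) -> reach a v.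

(** If s + t is connected to a, then s is adjacent to it when t is in [Psi], and reaches it by
    adding t otherwise. If an x is added first, [qroot_sum3] attaches x to s or to t. *)
Lemma reach_summands a w : Phi a -> reach a w -> forall s t, w = s + t ->
  pos s -> pos t -> rt w -> reach a s /\ reach a t.
Proof.
move=> ha; elim=> {w} [w aw|w x hx rwx _ IH] s t e ps pt rw; rewrite e in rw *.
  rewrite e in aw; have hst := conn_Phi aw ha.
  have ets : t + s = s + t by rewrite addrC.
  have viaPsi p q : Phi p -> Psi q -> p + q = s + t -> reach a p.
    move=> hp hq epq; apply/reach_conn/(conn_trans aw)/conn_edge/edgeP.
    by split=> //; rewrite -epq opprD addrA subrr sub0r; right; rewrite opprK.
  have viaPhi p q : Phi q -> p + q = s + t -> reach a p.
    by move=> hq epq; apply: reach_add hq _ _; rewrite epq //; exact: reach_conn.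
  have [hs|hs] := Phi_or_Psi ps; have [ht|ht] := Phi_or_Psi pt.
  - by split; [exact: (viaPhi s t)|exact: (viaPhi t s)].
  - by split; [exact: (viaPsi s t)|exact: (viaPhi t s)].
  - by split; [exact: (viaPhi s t)|exact: (viaPsi t s)].
  - by have [] := Psi_add hs ht rw.
rewrite e in rwx IH.
have := @qroot_sum3 x s t; case.
- exact: Phi_rt.
- exact: pos_rt.
- exact: pos_rt.
- by rewrite -addrA addrC.
- by apply: qpos_addr_neq0 => //; exact: Phi_pos.
- by apply: qpos_addr_neq0 => //; exact: Phi_pos.
- exact: qpos_addr_neq0.
- rewrite addrC => r; have psx := qpos_add ps (Phi_pos hx) r.
  have [h1 h2] := IH (s + x) t (addrAC _ _ _) psx pt rwx.
  by split=> //; exact: reach_add hx r h1.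
- rewrite addrC => r; have ptx := qpos_add pt (Phi_pos hx) r.
  have [h1 h2] := IH s (t + x) (esym (addrA _ _ _)) ps ptx rwx.
  by split=> //; exact: reach_add hx r h2.
Qed.

Lemma reach_theta a v i : Phi a -> pos v -> reach a v -> coef i v <> 0 ->
  reach a (theta i).
Proof.
move=> ha; move: v; apply: height_ind => v pv IH av.
have [j jJ [evj|pvj]] := qpos_descend pv.
  by rewrite evj coef_theta; case: eqP => [->|]; rewrite ?andbF // -evj.
have ev : v = (v - theta j) + theta j by rewrite subrK.
have [h1 h2] := reach_summands ha av ev pvj (qpos_theta jJ) (pos_rt pv).
rewrite {1}ev coefD coef_theta; case: eqP => [->//|_].
by rewrite andbF addr0; apply: IH => //; exact: height_sub_theta.
Qed.

Lemma below_connr u v w : below u v -> conn v w -> below u w.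
Proof.
move=> uv vw u' /uv[v' vv' h]; exists v' => //.
exact: conn_trans (conn_sym vw) vv'.
Qed.

Lemma below_connl u v w : conn u v -> below v w -> below u w.
Proof.
by move=> uv vw u' uu'; apply: vw; apply: conn_trans (conn_sym uv) uu'.
Qed.

(** Each addition stays in the component or climbs strictly, by [below_add]. *)
Lemma reach_below a v : reach a v -> Phi v -> conn v a \/ below v a.
Proof.
elim=> {v} [v av _|v x hx r _ IH hv]; first by left; exact: conn_sym.
have := IH (Phi_add hv hx r).
have [h1|h1] := below_add hv hx r; case=> h2.
- by left; exact: conn_trans h1 h2.
- by right; exact: below_connl h1 h2.
- by right; exact: below_connr h1 h2.
- by right; exact: below_trans h1 h2.
Qed.

(** * The four implications *)

Lemma set_suppP (A : vset R n) i : (forall w, A w -> Phi w) ->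
  set_supp Sig J A i <-> exists2 w, A w & coef i w <> 0.
Proof.
move=> AP; split=> [[w [Aw hw]]|[w Aw hw]]; exists w => //.
  by apply/in_suppP => //; exact/Phi_rt/AP.
by split=> //; apply/in_suppP => //; exact/Phi_rt/AP.
Qed.

(** For co-closedness, let u + v be in [P] with u, v outside. Two summands in [Q], or two in [Psi],
    contradict closedness; if one is in [Q] and the other in [Psi], the former is adjacent to u + v,
    hence in [P]. *)
Lemma inversion_set_part (P Q : vset R n) :
  (forall w, Phi w -> P w \/ Q w) -> (forall w, ~ (P w /\ Q w)) ->
  (forall w, P w -> Phi w) ->
  (forall u v, P u -> edge u v -> P v) ->
  closed_set D Sig J P -> closed_set D Sig J Q -> inversion_set D Sig J P.
Proof.
move=> PQ nPQ PPhi Pe cP cQ; split=> //; split=> [w [//]|u v [pu nu] [pv nv] r].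
split=> [|Puv]; first exact: qpos_add.
have mixed s t : s + t = u + v -> Q s -> Psi t -> P s.
  move=> e Qs ht; apply: (Pe (u + v)) => //; apply/edgeP; split.
  - exact: PPhi.
  - have [//|nhs] := Phi_or_Psi (cQ.1 _ Qs).
    have := Psi_add nhs ht; rewrite e => /(_ r)[_]; case; exact: PPhi.
  - by right; rewrite -e opprB addrAC subrr add0r.
have QPsi s : pos s -> ~ P s -> Q s \/ Psi s.
  move=> ps ns; have [/PQ[]|] := Phi_or_Psi ps; [by []|by left|by right].
have [hu|hu] := QPsi u pu nu; have [hv|hv] := QPsi v pv nv.
- by apply: (nPQ (u + v)); split=> //; exact: cQ.2.
- by apply: nu; exact: (mixed u v).
- by apply: nv; apply: (mixed v u) => //; rewrite addrC.
- by have [_] := Psi_add hu hv r; apply; exact: PPhi.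
Qed.

Lemma irreducible_supp : irreducible D Sig J Phi ->
  forall C, component D Sig J Phi C ->
  forall i, set_supp Sig J C i <-> set_supp Sig J Phi i.
Proof.
move=> [_ [_ irr]] _ /componentP[a ha ->] i.
rewrite !set_suppP //; last by move=> w [].
split=> [[w [hw _] cw]|[w0 hw0 cw0]]; first by exists w.
apply: contrapT => na.
pose P w := Phi w /\ exists2 w', conn w w' & coef i w' <> 0.
pose Q w := Phi w /\ forall w', conn w w' -> coef i w' = 0.
have PQ w : Phi w -> P w \/ Q w.
  move=> hw; have [h|h] := pselect (exists2 w', conn w w' & coef i w' <> 0).
    by left.
  right; split=> // w' ww'; apply: contrapT => c; apply: h; by exists w'.
have nPQ w : ~ (P w /\ Q w) by case=> -[_ [w' ww' c]] [_ h]; apply/c/h.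
have Pe u v : P u -> edge u v -> P v.
  move=> [_ [w uw c]] uv; split; first by have /edgeP[] := uv.
  by exists w => //; apply: conn_trans (conn_sym (conn_edge uv)) uw.
have Qe u v : Q u -> edge u v -> Q v.
  move=> [_ c] uv; split; first by have /edgeP[] := uv.
  by move=> w vw; apply: c; apply: conn_trans (conn_edge uv) vw.
have cP : closed_set D Sig J P.
  split=> [w [/Phi_pos //]|u v [hu [u' uu' cu']] [hv _] r].
  split; first exact: Phi_add.
  have [uv|nuv] := pselect (conn u (u + v)).
    by exists u' => //; apply: conn_trans (conn_sym uv) uu'.
  have [x [hx _ h]] := conn_summand hu hv r nuv uu'; exists (u' + x) => //.
  rewrite coefD => /eqP; have /qposP[_ cx] := Phi_pos hx.
  have /qposP[_ cu] := Phi_pos (conn_Phi uu' hu).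
  by rewrite paddr_eq0 // => /andP[/eqP].
have cQ : closed_set D Sig J Q.
  split=> [w [/Phi_pos //]|u v [hu cu] [hv cv] r].
  split; first exact: Phi_add.
  move=> w uvw.
  have [uv|nuv] := pselect (conn u (u + v)).
    by apply: cu; exact: conn_trans uv uvw.
  have [vu|nvu] := pselect (conn v (u + v)).
    by apply: cv; exact: conn_trans vu uvw.
  have [u' [v' [uu' vv' ->]]] := conn_split hu hv r nuv nvu uvw.
  by rewrite coefD cu // cv // addr0.
have iP : inversion_set D Sig J P.
  by apply: (@inversion_set_part P Q) => // w [].
have iQ : inversion_set D Sig J Q.
  apply: (@inversion_set_part Q P) => // [w /PQ[]|w [hq hp]|w []] //; auto.
  by apply: (nPQ w).
have [|e|e] := irr P Q iP iQ nPQ.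
- by move=> w; split=> [/PQ //|[[]|[]]].
- have : P a by rewrite e.
  by move=> [_ [w aw cw]]; apply: na; exists w => //; split=> //; exact: conn_Phi aw ha.
- by have : Q w0 by [rewrite e]; move=> [_ /(_ w0 (conn_refl _))].
Qed.

Lemma supp_unique_simple : (exists w, Phi w) ->
  (forall C, component D Sig J Phi C ->
   forall i, set_supp Sig J C i <-> set_supp Sig J Phi i) ->
  exists C, simple_comp D Sig J Phi C /\
    forall C', simple_comp D Sig J Phi C' -> C' = C.
Proof.
move=> [w hw] full; have [i iJ hi] := Phi_theta hw.
(* Full support gives v in the component of theta_k involving theta_j, so theta_j reaches
   theta_k. *)
have cmp j k : j \notin J -> Phi (theta j) -> Phi (theta k) ->
    conn (theta j) (theta k) \/ below (theta j) (theta k).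
  move=> jJ hj hk; apply: reach_below => //.
  have /set_suppP[|v [hv kv] cv] : set_supp Sig J (cl (theta k)) j.
  - apply/(full _ (component_cl hk))/set_suppP => //; exists (theta j) => //.
    by rewrite coef_theta jJ eqxx; exact/eqP/oner_neq0.
  - by move=> v [].
  apply: (reach_theta hk (Phi_pos hv)) => //; exact: reach_conn.
exists (cl (theta i)); split; first by apply/simple_compP => //; exact: indec_theta.
move=> C' sC'; have /componentP[b hb eC'] := sC'.1.
move: sC'; rewrite eC' => /(simple_compP hb) ib.
have [j [jJ hj bj]] := indec_conn_theta hb ib.
rewrite (cl_conn bj); apply/cl_conn.
have [//|h1] := cmp j i jJ hj hi; have [/conn_sym//|h2] := cmp i j iJ hi hj.
by case: (below_irr hi); exact: below_trans h2 h1.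
Qed.

(** If w is decomposable, [conn_split] carries a splitting found elsewhere in its component over to
    w itself, with parts of smaller height. *)
Lemma sum_of_indec a : (forall b, Phi b -> indec b -> conn a b) ->
  forall w, pos w -> Phi w ->
  exists2 l : seq 'rV[R]_n, (forall x, x \in l -> cl a x) & w = \sum_(x <- l) x.
Proof.
move=> ha; apply: height_ind => w pw IH hw.
have [iw|niw] := pselect (indec w).
  exists [:: w]; last by rewrite big_seq1.
  by move=> x; rewrite inE => /eqP ->; split=> //; exact: ha.
have [x [y [hx hy r wxy [nx ny]]]] : exists x y, [/\ Phi x, Phi y, rt (x + y),
    conn w (x + y) & ~ conn w x /\ ~ conn w y].
  apply: contrapT => h; apply: niw => x y hx hy r wxy; apply: contrapT => /not_orP nxy.
  by apply: h; exists x, y.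
have [||x' [y' [xx' yy' e]]] := conn_split hx hy r _ _ (conn_sym wxy).
- by move=> h; apply: nx; exact: conn_trans wxy (conn_sym h).
- by move=> h; apply: ny; exact: conn_trans wxy (conn_sym h).
have hx' := conn_Phi xx' hx; have hy' := conn_Phi yy' hy.
have hX := height_gt0 (Phi_pos hx'); have hY := height_gt0 (Phi_pos hy').
have [|k hk ek] := IH x' (Phi_pos hx') _ hx'; first by rewrite e heightD ltrDl.
have [|l hl el] := IH y' (Phi_pos hy') _ hy'; first by rewrite e heightD ltrDr.
exists (k ++ l); last by rewrite e ek el big_cat.
by move=> z; rewrite mem_cat => /orP[/hk|/hl].
Qed.

(** As (w, w) > 0, some x in the list has (w, x) > 0, so w - x is zero or a root to which induction
    applies. Adding x back changes k only if w leaves the components of w - x and x. *)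
Lemma kmul_sum a m : Phi a -> forall l : seq 'rV[R]_n, size l = m ->
  (forall x, x \in l -> cl a x) -> rt (\sum_(x <- l) x) ->
  Phi (\sum_(x <- l) x) /\
  exists k, (0 < k)%N /\ kmul D Sig J Phi k (cl a) (cl (\sum_(x <- l) x)).
Proof.
move=> ha; elim: m => [|m IH] l sl la; set w := \sum_(x <- l) x => rw.
  by case: (qroot_neq0 rw); rewrite /w (size0nil sl) big_nil.
have [x xl wx] : exists2 x, x \in l & 0 < dot w x.
  apply: contrapT => h; have := dot_gt0 (qroot_neq0 rw).
  rewrite {2}/w dot_sumr big_seq => /lt_geF/negP; apply.
  by apply: sumr_le0 => x xl; rewrite leNgt; apply/negP => wx; apply: h; exists x.
have [hx ax] := la x xl.
have ew : w = \sum_(y <- rem x l) y + x by rewrite /w (big_rem x) //= addrC.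
have one v : cl a v -> exists k, (0 < k)%N /\ kmul D Sig J Phi k (cl a) (cl v).
  move=> [hv av]; exists 1%N; split=> //; split; first exact: component_cl.
  exact/esym/cl_conn.
have [|] := qroot_sub rw (Phi_rt hx) wx.
  by move=> /eqP; rewrite subr_eq0 => /eqP ->; split=> //; exact: one.
rewrite ew addrK => r; have [||hv [k [k0 hk]]] := IH (rem x l) _ _ r.
- by rewrite size_rem // sl.
- by move=> y /mem_rem; exact: la.
move: r hv hk ew; set v := \sum_(y <- _) y => r hv hk ew.
have rvx : rt (v + x) by rewrite -ew.
have hw := Phi_add hv hx rvx; split=> //.
have [vw|nvw] := pselect (conn v (v + x)); first by exists k; rewrite -(cl_conn vw).
have [xw|nxw] := pselect (conn x (v + x)).
  by apply: one; split=> //; exact: conn_trans ax xw.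
(* [kmul] unfolds to a sum only from index 2 on. *)
exists k.+1; split=> //; case: k k0 hk => // k _ hk.
exists (cl v); split=> //; rewrite (cl_conn ax); exact: csum_cl.
Qed.

Lemma unique_simple_generates :
  (exists C, simple_comp D Sig J Phi C /\
    forall C', simple_comp D Sig J Phi C' -> C' = C) ->
  exists A, component D Sig J Phi A /\
    forall C, component D Sig J Phi C -> C <> A ->
      exists k, (1 <= k)%N /\ kmul D Sig J Phi k A C.
Proof.
move=> [_ [[/componentP[a ha ->] _] ua]].
exists (cl a); split; first exact: component_cl.
move=> _ /componentP[w hw ->] _.
have [b hb ib|l hl ew] := @sum_of_indec a _ w (Phi_pos hw) hw.
  by apply: cl_inj => //; apply/esym/ua/simple_compP.
have [|_] := kmul_sum ha (erefl (size l)) hl; first by rewrite -ew; exact: Phi_rt.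
by rewrite -ew.
Qed.

Lemma generated_irreducible : (exists w, Phi w) ->
  (exists A, component D Sig J Phi A /\
    forall C, component D Sig J Phi C -> C <> A ->
      exists k, (1 <= k)%N /\ kmul D Sig J Phi k A C) ->
  irreducible D Sig J Phi.
Proof.
move=> nonempty [_ [/componentP[a ha ->] gen]]; split=> //; split=> //.
have part P Q : inversion_set D Sig J P -> inversion_set D Sig J Q ->
    (forall w, ~ (P w /\ Q w)) -> (forall w, Phi w <-> P w \/ Q w) ->
    P a -> P = Phi.
  move=> [[posP cP] [_ ccP]] [[posQ cQ] [_ ccQ]] nPQ PQ Pa.
  have PsiP w : Psi w -> compl D Sig J P w.
    by case=> pw nw; split=> // Pw; apply/nw/PQ; left.
  have PsiQ w : Psi w -> compl D Sig J Q w.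
    by case=> pw nw; split=> // Qw; apply/nw/PQ; right.
  (* The larger end of an edge is the smaller end plus a root of [Psi]. Across the two parts, both
     summands would avoid the part of the larger end, against its co-closedness. *)
  have Pe u v : P u -> edge u v -> P v.
    move=> Pu /edgeP[hu hv h]; have /PQ[//|Qv] := hv; exfalso; case: h => h.
      have cu : compl D Sig J Q u.
        by split; [exact: posP|move=> Qu; apply: (nPQ u)].
      by have := ccQ _ _ cu (PsiQ _ h); rewrite subrKC => /(_ (Phi_rt hv))[_]; apply.
    have cv : compl D Sig J P v.
      by split; [exact: posQ|move=> Pv; apply: (nPQ v)].
    have := ccP _ _ cv (PsiP _ h); rewrite opprB subrKC => /(_ (Phi_rt hu))[_].
    exact.
  have Pc u v : P u -> conn u v -> P v.
    by move=> Pu; move: v; apply: conn_ind => // x y _; exact: Pe.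
  have Pk k C : kmul D Sig J Phi k (cl a) C -> forall w, C w -> P w.
    elim: k C => // -[_|k IH] C; first by move=> [_ ->] w [_ aw]; exact: Pc aw.
    move=> [E [/IH hE hC]] w Cw; have [x [y [Ex [hy ay] r Cxy]]] := csum_mem hC.
    have Pxy : P (x + y) by apply: cP => //; [exact: hE|exact: Pc ay].
    have [_ _ cC _] := hC; have [_ eC] := component_mem cC Cxy.
    by move: Cw; rewrite eC => -[_]; exact: Pc.
  apply/funext => w; apply/propext; split=> [Pw|hw]; first by apply/PQ; left.
  have [e|ne] := pselect (cl w = cl a).
    by have := cl_self hw; rewrite e => -[_]; exact: Pc.
  have [k [_ hk]] := gen _ (component_cl hw) ne.
  by apply: Pk hk _ _; exact: cl_self.
move=> P Q iP iQ nPQ PQ; have /PQ[Pa|Qa] := ha.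
  by left; exact: (part P Q).
right; apply: (part Q P) => // [w [h1 h2]|w]; first by apply: (nPQ w).
by rewrite PQ; split=> -[]; auto.
Qed.

End QuotientRoots.

Theorem theorem5p2 (R : realType) (n : nat) (I : finType)
  (D : seq 'rV[R]_n) (Sig : I -> 'rV[R]_n) (J : {set I}) (Phi : vset R n) :
  is_root_system D -> is_base D Sig -> J != setT ->
  inversion_set D Sig J Phi -> (exists w, Phi w) ->
  [<-> irreducible D Sig J Phi;
       forall C, component D Sig J Phi C ->
         forall i, set_supp Sig J C i <-> set_supp Sig J Phi i;
       exists C, simple_comp D Sig J Phi C /\
         forall C', simple_comp D Sig J Phi C' -> C' = C;
       exists A, component D Sig J Phi A /\
         forall C, component D Sig J Phi C -> C <> A ->
           exists k, (1 <= k)%N /\ kmul D Sig J Phi k A C].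
Proof.
move=> hD hS _ hPhi nonempty; tfae.
- exact: irreducible_supp.
- exact: supp_unique_simple.
- exact: unique_simple_generates.
- exact: generated_irreducible.
Qed.
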